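(* Let $p\ge 0$, and let $\{(\mathcal{V},\mathcal{E}^n)\}_{n\in\mathbb{N}_0}$ be a (random) time-varying network that is $(\varepsilon,\kappa)$-stochastically strongly connected for some $\varepsilon\in(0,1)$ and $\kappa\in\mathbb{N}_0$, with associated strongly connected graph $(\mathcal{V},\mathcal{E})$. Suppose that for each $(i,j)\in\mathcal{E}$ there is some $\eta\in\mathbb{N}_0$ such that the process $\big\{\mathbf{1}_{\bigcup_{k=n}^{n+\eta}A_{ij}^k}\big\}_{n\in\mathbb{N}_0}$ is $p$-strongly mixing. Then all AoI variables $\tau_{ij}(n)$ are stochastically dominated by a single random variable with finite $p$-th moment; that is, there is a non-negative integer-valued random variable $\overline{\tau}$ with $\mathbb{E}[\overline{\tau}^p]<\infty$ such that $\mathbb{P}(\tau_{ij}(n)>m)\le\mathbb{P}(\overline{\tau}>m)$ for all $m\ge0$, all $i,j\in\mathcal{V}$ and all $n\in\mathbb{N}_0$.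
   Context: Time-varying network: $\mathcal{V}=\{1,\ldots,D\}$ is a finite set of nodes (agents), and $\{(\mathcal{V},\mathcal{E}^n)\}_{n\in\mathbb{N}_0}$ is a sequence of random directed graphs on $\mathcal{V}$, defined on a probability space. $A_{ij}^n$ denotes the event $(i,j)\in\mathcal{E}^n$, i.e. that agent $i$ successfully transmits its latest available information about all agents to agent $j$ during time slot $n$ (the interval from time step $n-1$ to $n$). The network is $(\varepsilon,\kappa)$-stochastically strongly connected (SSC) if there is a strongly connected directed graph $(\mathcal{V},\mathcal{E})$ (every pair of nodes is connected by a directed path) such that $\mathbb{P}\big(\bigcup_{k=n}^{n+\kappa}A_{ij}^k\big)\ge\varepsilon$ for all $n\in\mathbb{N}_0$ and all $(i,j)\in\mathcal{E}$; this $(\mathcal{V},\mathcal{E})$ is the associated strongly connected graph. Age of Information (AoI): $\tau_{ij}(n)$ is the age, at time $n$, of the newest information originating at agent $i$ that is available at agent $j$, where information spreads by agents transmitting everything they know. Explicitly, $\tau_{ii}(n)=0$ for all $n$, $\tau_{ij}(0)=0$, and for $i\ne j$, $n\ge1$, $$\tau_{ij}(n)=1+\min\big(\{\tau_{ij}(n-1)\}\cup\{\tau_{il}(n-1): l\in\mathcal{V},\ (l,j)\in\mathcal{E}^n\}\big).$$ Mixing: for sub-$\sigma$-algebras $\mathcal{A},\mathcal{B}$, let $\alpha(\mathcal{A},\mathcal{B})=\sup_{A\in\mathcal{A},B\in\mathcal{B}}|\mathbb{P}(A\cap B)-\mathbb{P}(A)\mathbb{P}(B)|$. For a process $X=\{X_n\}_{n\in\mathbb{N}_0}$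 let $\mathcal{F}_l^m=\sigma(X_n\mid l\le n\le m)$ for $0\le l\le m\le\infty$, and $\alpha(n)=\sup_{l\ge0}\alpha(\mathcal{F}_0^l,\mathcal{F}_{l+n}^\infty)$. For $p\ge0$, $X$ is $p$-strongly mixing if $\sum_{n}n^{p-1}\alpha(n)<\infty$ (for $p<1$ the $n=0$ term is omitted). For $p=0$ the condition $\mathbb{E}[\overline\tau^p]<\infty$ is void, so the conclusion is the mere existence of a dominating random variable. *)

(* Defs.v *)
From HB Require Import structures.
From mathcomp Require Import all_boot all_order all_algebra.
From mathcomp Require Import all_classical all_reals all_analysis.

Set Implicit Arguments.
Unset Strict Implicit.
Unset Printing Implicit Defensive.

Import Order.TTheory GRing.Theory Num.Theory.
Local Open Scope classical_set_scope.
Local Open Scope ring_scope.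

(* The directed graph drawn in slot n is given by its adjacency relation
   E n w : rel V; link_event E i j n is the event "(i, j) is an edge of the
   n-th graph", and measurability of all these events makes E a sequence of
   random graphs. *)
Definition link_event (T : Type) (V : finType) (E : nat -> T -> rel V)
  (i j : V) (n : nat) : set T := [set w | E n w i j].

Definition random_network d (T : measurableType d) (V : finType)
  (E : nat -> T -> rel V) : Prop :=
  forall i j n, measurable (link_event E i j n).

Definition window_event (T : Type) (V : finType) (E : nat -> T -> rel V)
  (i j : V) (s n : nat) : set T :=
  \bigcup_(k in [set k | (n <= k <= n + s)%N]) link_event E i j k.

Definition strongly_connected (V : finType) (G : rel V) : Prop :=
  forall i j, connect G i j.

Definition stoch_strongly_connected d (T : measurableType d) (R : realType)
  (P : probability T R) (V : finType) (E : nat -> T -> rel V)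
  (eps : R) (kappa : nat) (G : rel V) : Prop :=
  strongly_connected G /\
  forall (n : nat) (i j : V), G i j ->
    (eps%:E <= P (window_event E i j kappa n))%E.

(* The \min below starts from aoi e m i j, so it is the minimum of the union
   of {aoi e m i j} and {aoi e m i l : (l, j) an edge}. The edge set of index
   n is used between times n - 1 and n; that of index 0 is never used. *)
Fixpoint aoi (V : finType) (e : nat -> rel V) (n : nat) (i j : V) : nat :=
  if i == j then 0%N else
  match n with
  | 0%N => 0%N
  | m.+1 => (\big[minn/aoi e m i j]_(l | e m.+1 l j) aoi e m i l).+1
  end.

Definition process_sigma_algebra d d' (T : measurableType d)
  (T' : measurableType d') (X : nat -> T -> T') (I : set nat) : set (set T) :=
  <<s \bigcup_(n in I) preimage_set_system setT (X n) measurable >>.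

Definition alpha_dep d (T : measurableType d) (R : realType)
  (P : probability T R) (SA SB : set (set T)) : \bar R :=
  ereal_sup [set `|P (AB.1 `&` AB.2) - P AB.1 * P AB.2|%E | AB in SA `*` SB].

Definition alpha_coef d d' (T : measurableType d) (T' : measurableType d')
  (R : realType) (P : probability T R) (X : nat -> T -> T') (n : nat)
  : \bar R :=
  ereal_sup (range (fun l : nat =>
    alpha_dep P (process_sigma_algebra X [set k | (k <= l)%N])
                (process_sigma_algebra X [set k | (l + n <= k)%N]))).

(* For p < 1 the exponent p - 1 is negative and the term n = 0 is left out. *)
Definition strongly_mixing d d' (T : measurableType d) (T' : measurableType d')
  (R : realType) (P : probability T R) (p : R) (X : nat -> T -> T') : Prop :=
  (forall n, measurable_fun setT (X n)) /\
  (\sum_(0 <= n <oo | (1 <= p)%R || (0 < n)%N)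
     (n%:R `^ (p - 1))%:E * alpha_coef P X n < +oo)%E.

(* Main.v *)
(* If each link of a path from i to j is active at least once in consecutive
   time intervals of length M, then tau_ij is at most M times the length of the
   path. So, with f_e(M) = sup_s P(link e is not active during [s, s + M)),
     P(tau_ij(n) > D M) <= D sum_(e in G) f_e(M).
   Separating two intervals by a gap g gives f_e(a + g + b) <= f_e(a) f_e(b) +
   alpha(g). As f_e(kappa + 1) <= 1 - eps and alpha tends to 0, f_e tends to 0,
   whence f_e(3M) <= delta f_e(M) + alpha(M) with delta 3^p <= 1/2 for large M.
   By condensation, sum_n n^(p-1) alpha(n) < oo bounds
   sum_k 3^(kp) alpha(3^k), so sum_k 3^(kp) f_e(3^k) < oo, which is the p-th
   moment of a variable that dominates all ages. *)
Require Import Defs.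
From HB Require Import structures.
From mathcomp Require Import all_boot all_order all_algebra.
From mathcomp Require Import all_classical all_reals all_analysis.
From mathcomp Require Import zify ring lra.

Set Implicit Arguments.
Unset Strict Implicit.
Unset Printing Implicit Defensive.

Import Order.TTheory GRing.Theory Num.Theory.
Local Open Scope classical_set_scope.
Local Open Scope ring_scope.

(** * Real sequences: bounded partial sums and recursive inequalities *)

Definition bounded_sums (R : numDomainType) (u : nat -> R) : Prop :=
  exists C, forall N, \sum_(0 <= k < N) u k <= C.

Lemma bounded_sums_halving (R : realFieldType) (b beta : nat -> R) (k0 : nat) :
  (forall k, 0 <= b k) -> (forall k, 0 <= beta k) ->
  (forall k, (k0 <= k)%N -> b k.+1 <= b k / 2 + beta k) ->
  bounded_sums beta -> bounded_sums b.
Proof.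
move=> b0 beta0 hb [C hC].
(* The term [2 * b (k0 + N)] is a potential: the recursion gives
   [b k + 2 * b k.+1 <= 2 * b k + 2 * beta k], so it pays for each new summand up to
   [2 * beta k]. *)
have main N : \sum_(0 <= k < k0 + N) b k + 2 * b (k0 + N)%N <=
    \sum_(0 <= k < k0) b k + 2 * b k0 + 2 * \sum_(0 <= k < k0 + N) beta k.
  elim: N => [|N IH].
    by rewrite addn0 lerDl mulr_ge0// sumr_ge0.
  rewrite addnS !big_nat_recr//=.
  have := hb (k0 + N)%N (leq_addr _ _); lra.
exists (\sum_(0 <= k < k0) b k + 2 * b k0 + 2 * C) => N.
have le_N : \sum_(0 <= k < N) b k <= \sum_(0 <= k < k0 + N) b k.
  by rewrite [leRHS](big_cat_nat (n := N)) ?leq_addl//= lerDl sumr_ge0.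
have := main N; have := hC (k0 + N)%N; have := b0 (k0 + N)%N; lra.
Qed.

Lemma powR_nat_exp (R : realType) (p : R) (m k : nat) :
  (m ^ k)%:R `^ p = (m%:R `^ p) ^+ k.
Proof. by rewrite natrX -powR_mulrn// powRAC powR_mulrn ?powR_ge0. Qed.

Lemma powR_ge1 (R : realType) (a p : R) : 1 <= a -> 0 <= p -> 1 <= a `^ p.
Proof.
move=> a1 p0; have -> : 1 = 1 `^ p :> R by rewrite powR1.
apply: ge0_ler_powR => //.
  by rewrite nnegrE.
by rewrite nnegrE (le_trans _ a1).
Qed.

(** Cauchy condensation in base 3. The block from [3 ^ K] to [3 ^ K.+1] has [2 * 3 ^ K] terms, each
    at least 3^(Kp) 3^-(K+1) [al (3 ^ K.+1)], which explains the factor 2/3 and the evaluation of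
    [al] at the right end of the block. *)
Lemma bounded_sums_condensation (R : realType) (p : R) (al : nat -> R) :
  0 <= p -> (forall n, 0 <= al n) ->
  (forall m n, (0 < m <= n)%N -> al n <= al m) ->
  (exists S, forall N, \sum_(1 <= n < N) n%:R `^ (p - 1) * al n <= S) ->
  bounded_sums (fun k => (3 `^ p) ^+ k * al (3 ^ k.+1)%N).
Proof.
move=> p0 al0 al_dec [S hS].
have block K : \sum_(0 <= k < K) (3 `^ p) ^+ k * al (3 ^ k.+1)%N * (2 / 3) <=
    \sum_(1 <= n < 3 ^ K) n%:R `^ (p - 1) * al n.
  elim: K => [|K IH]; first by rewrite expn0 !big_geq.
  have lt_pow : (3 ^ K <= 3 ^ K.+1)%N by rewrite leq_exp2l.
  rewrite big_nat_recr//= [leRHS](big_cat_nat (n := (3 ^ K)%N)) ?expn_gt0//=.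
  apply: lerD => //.
  set c := (3 `^ p) ^+ K * al (3 ^ K.+1)%N.
  apply: (@le_trans _ _ (\sum_(3 ^ K <= n < 3 ^ K.+1) c / (3 ^ K.+1)%:R)).
    rewrite sumr_const_nat -[leRHS]mulr_natr -[leRHS]mulrA ler_wpM2l//.
      by rewrite mulr_ge0// exprn_ge0// powR_ge0.
    have -> : (3 ^ K.+1 - 3 ^ K = 2 * 3 ^ K)%N by rewrite expnS; lia.
    rewrite expnS !natrM; have : (3 ^ K)%:R != 0 :> R.
      by rewrite pnatr_eq0 expn_eq0.
    by move=> ?; rewrite le_eqVlt; apply/orP; left; apply/eqP; field.
  apply: ler_sum_nat => n /andP[len ltn].
  have n0 : (0 < n)%N by rewrite (leq_trans _ len)// expn_gt0.
  rewrite /c mulrAC; apply: ler_pM => //.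
  (* As [p - 1] may have either sign, n^(p-1) is split into n^p and 1/n, bounded below at the left
     and at the right end of the block respectively. *)
  - rewrite powRB ?pnatr_eq0 -?lt0n ?n0 ?implybT// powRr1//.
    apply: ler_pM; rewrite ?invr_ge0 ?exprn_ge0 ?powR_ge0//.
      by rewrite -powR_nat_exp; apply: ge0_ler_powR; rewrite ?nnegrE ?ler_nat.
    by rewrite lef_pV2 ?posrE ?ltr0n ?expn_gt0// ler_nat ltnW.
  - by apply: al_dec; rewrite n0 ltnW.
exists (S * (3 / 2)) => N.
have := le_trans (block N) (hS _); rewrite -mulr_suml; lra.
Qed.

Lemma bounded_sums_small (R : realType) (u : nat -> R) (d : R) :
  0 < d -> bounded_sums u -> exists k, u k <= d.
Proof.
move=> d0 [C hC]; apply: contrapT => /forallNP hu.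
have ltd k : d < u k by rewrite ltNge; apply/negP/hu.
have := hC (Num.truncn (C / d)).+1.
have : \sum_(0 <= k < (Num.truncn (C / d)).+1) d <=
       \sum_(0 <= k < (Num.truncn (C / d)).+1) u k.
  by apply: ler_sum => k _; exact: ltW.
rewrite sumr_const_nat subn0 -[d *+ _]mulr_natl.
have := truncnS_gt (C / d); rewrite ltr_pdivrMr//; lra.
Qed.

(* If L = inf f were positive, L <= f (a0 + g + m) <= (1 - eps) f m + al g with
   f m close to L and al g close to 0 would be contradictory. *)
Lemma submultiplicative_small (R : realType) (f al : nat -> R) (eps : R)
    (eta a0 : nat) :
  0 < eps -> (forall n, 0 <= f n) -> (forall m n, (m <= n)%N -> f n <= f m) ->
  (forall d, 0 < d -> exists2 g, (0 < g)%N & al g <= d) ->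
  (forall a g b, (eta < a)%N -> (eta < b)%N -> (0 < g)%N ->
     f (a + g + b)%N <= f a * f b + al g) ->
  (eta < a0)%N -> f a0 <= 1 - eps ->
  forall d, 0 < d -> exists m, f m <= d.
Proof.
move=> eps0 f0 f_dec al_small f_mul eta_a0 fa0 d d0.
apply: contrapT => /forallNP hf.
have ltd k : d < f k by rewrite ltNge; apply/negP/hf.
set L := inf (range f).
have hinf : has_inf (range f).
  by split; [exists (f 0); exists 0 | exists 0 => _ [n _ <-]].
have leL n : L <= f n by apply: ge_inf; [exact: hinf.2 | exists n].
have L0 : 0 < L.
  apply: (lt_le_trans d0); apply: lb_le_inf; first exact: hinf.1.
  by move=> _ [n _ <-]; exact: ltW.
(* Two errors of this size leave (1 - eps) (L + eps L / 4) + eps L / 4 = L - eps L / 2 - eps^2 L / 4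
   < L. *)
have dL : 0 < eps * L / 4 by rewrite divr_gt0// mulr_gt0.
have [_ [m _ <-] hm] := inf_adherent dL hinf.
have [g g0 hg] := al_small _ dL.
have eps1 : 0 <= 1 - eps by exact: le_trans (f0 a0) fa0.
pose b := maxn m eta.+1.
have hfb : f b < L + eps * L / 4.
  by apply: le_lt_trans hm; apply: f_dec; rewrite leq_maxl.
have := f_mul a0 g b eta_a0 (leq_maxr _ _) g0.
have : f a0 * f b <= (1 - eps) * f b by rewrite ler_wpM2r.
have : (1 - eps) * f b <= (1 - eps) * (L + eps * L / 4).
  by rewrite ler_wpM2l// ltW.
have := leL (a0 + g + b)%N; have : 0 < eps * (eps * L) by rewrite !mulr_gt0.
lra.
Qed.

(** An interval of length [3 ^ k.+1] is cut into three equal pieces, the middle one serving as the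
    gap. Once [f (3 ^ k)] is at most 1 / (2c) with c = 3^p, one factor absorbs the growth c of the
    weight and leaves 1/2, so the halving lemma applies. *)
Lemma bounded_sums_submultiplicative (R : realType) (f al : nat -> R) (eps p : R)
    (eta a0 : nat) :
  0 < eps -> 0 <= p ->
  (forall n, 0 <= f n) -> (forall m n, (m <= n)%N -> f n <= f m) ->
  (forall n, 0 <= al n) ->
  (forall m n, (0 < m <= n)%N -> al n <= al m) ->
  (exists S, forall N, \sum_(1 <= n < N) n%:R `^ (p - 1) * al n <= S) ->
  (forall a g b, (eta < a)%N -> (eta < b)%N -> (0 < g)%N ->
     f (a + g + b)%N <= f a * f b + al g) ->
  (eta < a0)%N -> f a0 <= 1 - eps ->
  bounded_sums (fun k => (3 `^ p) ^+ k * f (3 ^ k)%N).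
Proof.
move=> eps0 p0 f0 f_dec al0 al_dec al_sum f_mul eta_a0 fa0.
have cond := bounded_sums_condensation p0 al0 al_dec al_sum.
have c1 : 1 <= (3 : R) `^ p by rewrite powR_ge1// ler1n.
set c : R := 3 `^ p in cond c1 *.
have c0 : 0 < c by rewrite (lt_le_trans _ c1).
have al_small d : 0 < d -> exists2 g, (0 < g)%N & al g <= d.
  move=> d0; have [k hk] := bounded_sums_small d0 cond.
  exists (3 ^ k.+1)%N; first by rewrite expn_gt0.
  by apply: le_trans hk; rewrite ler_peMl// exprn_ege1.
have d0 : 0 < (2 * c)^-1 by rewrite invr_gt0 mulr_gt0.
have [m hm] :=
  submultiplicative_small eps0 f0 f_dec al_small f_mul eta_a0 fa0 d0.
have le3 n : (n < 3 ^ n)%N by rewrite ltn_expl.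
(* From index [maxn m eta] on, [3 ^ k] exceeds both [eta], as the splitting requires, and [m], where
   [f] is already small. *)
apply: (@bounded_sums_halving _ _ (fun k => c ^+ k.+1 * al (3 ^ k)%N)
  (maxn m eta)) => [k|k|k|].
- by rewrite mulr_ge0// exprn_ge0// ltW.
- by rewrite mulr_ge0// exprn_ge0// ltW.
- rewrite geq_max => /andP[mk etak].
  have etak3 : (eta < 3 ^ k)%N by exact: leq_ltn_trans etak (le3 k).
  have pow3_gt0 : (0 < 3 ^ k)%N by rewrite expn_gt0.
  have := f_mul _ _ _ etak3 etak3 pow3_gt0.
  have -> : (3 ^ k + 3 ^ k + 3 ^ k = 3 ^ k.+1)%N by rewrite expnS; lia.
  have fd : f (3 ^ k)%N <= (2 * c)^-1.
    by apply: le_trans hm; apply: f_dec; exact: leq_trans mk (ltnW (le3 k)).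
  move=> h; rewrite [c ^+ k.+1]exprS -mulrA.
  apply: le_trans (_ : c * (c ^+ k * (f (3 ^ k)%N * (2 * c)^-1 + al (3 ^ k)%N)) <= _).
    rewrite ler_pM2l// ler_pM2l ?exprn_gt0//; apply: le_trans h _.
    by rewrite lerD2r ler_wpM2l.
  rewrite le_eqVlt; apply/orP; left; apply/eqP.
  by field; rewrite gt_eqF.
have [C hC] := cond.
(* The condensed series pairs c^k with [al (3 ^ k.+1)], here paired with c^(k+2); hence the factor
   c^2 and the separate term at index 0. *)
exists (c * al 1%N + c ^+ 2 * C) => -[|N].
  rewrite big_geq// addr_ge0// mulr_ge0 ?exprn_ge0 ?(ltW c0)//.
  by have := hC 0; rewrite big_geq.
rewrite big_nat_recl//= expr1 expn0 lerD2l.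
apply: le_trans (_ : c ^+ 2 * \sum_(0 <= k < N) c ^+ k * al (3 ^ k.+1)%N <= _).
  by rewrite mulr_sumr; apply: ler_sum => k _; rewrite mulrA -exprD.
by rewrite ler_pM2l ?exprn_gt0.
Qed.

(** * Pathwise bounds on the age of information *)

Lemma ltn_bigminP (I : finType) (Q : pred I) (F : I -> nat) (x c : nat) :
  reflect ((c < x)%N /\ forall l, Q l -> (c < F l)%N)
    (c < \big[minn/x]_(l | Q l) F l)%N.
Proof. exact: (@bigmin_gtP _ nat). Qed.

Section AgeOfInformation.
Context {V : finType}.
Implicit Types (e : nat -> rel V) (i j l : V) (n k M c : nat).

Lemma aoi_diag e n i : aoi e n i i = 0%N.
Proof. by case: n => [|n] /=; rewrite eqxx. Qed.

(** Strict lower bounds turn the minimum into a conjunction, which yields upper bounds by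
    contradiction and measurability by induction. The case [c = 0] stands apart because an
    off-diagonal age at a positive time is a successor. *)
Lemma ltn_aoiSP e n i j c : i != j ->
  reflect (c = 0%N \/ (c.-1 < aoi e n i j)%N /\
                   forall l, e n.+1 l j -> (c.-1 < aoi e n i l)%N)
    (c < aoi e n.+1 i j)%N.
Proof.
move=> ij; rewrite /= (negPf ij).
case: c => [|c]; first by apply: ReflectT; left.
by rewrite ltnS; apply: (iffP (ltn_bigminP _ _ _ _)); [right | case].
Qed.

Lemma aoiS_le e n i j : (aoi e n.+1 i j <= (aoi e n i j).+1)%N.
Proof.
have [->|ij] := eqVneq i j; first by rewrite !aoi_diag.
by rewrite leqNgt; apply/negP => /(ltn_aoiSP _ _ _ ij)[//|[]]; rewrite ltnn.
Qed.

Lemma aoiS_link e n i j l :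
  e n.+1 l j -> (aoi e n.+1 i j <= (aoi e n i l).+1)%N.
Proof.
move=> elj; have [->|ij] := eqVneq i j; first by rewrite !aoi_diag.
rewrite leqNgt; apply/negP => /(ltn_aoiSP _ _ _ ij)[//|[_ /(_ _ elj)]].
by rewrite ltnn.
Qed.

Lemma aoiD_le e n k i j : (aoi e (n + k) i j <= aoi e n i j + k)%N.
Proof.
elim: k => [|k IH]; first by rewrite !addn0.
by rewrite !addnS (leq_trans (aoiS_le _ _ _ _)).
Qed.

Lemma aoi_le_time e n i j : (aoi e n i j <= n)%N.
Proof.
by have := aoiD_le e 0 n i j; rewrite add0n /=; case: ifP.
Qed.

(** What [l] knows at time [n] ages by [k - 1 - n] until slot [k], by one while crossing the link,
    and by [n + M - k] afterwards: [M] in total. *)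
Lemma aoiD_link e n M k i j l : (n < k <= n + M)%N -> e k l j ->
  (aoi e (n + M) i j <= aoi e n i l + M)%N.
Proof.
case: k => // k /andP[nk kM] elj.
have -> : (n + M = k.+1 + (n + M - k.+1))%N by lia.
apply: leq_trans (aoiD_le _ _ _ _ _) _.
have := aoiS_link i elj; have := aoiD_le e n (k - n) i l.
rewrite subnKC//; lia.
Qed.

End AgeOfInformation.

(** * Probabilities that a link stays inactive, and tails of the ages *)

Definition quiet (T : Type) (V : finType) (E : nat -> T -> rel V)
    (i j : V) (s M : nat) : set T :=
  [set w | forall k, (s <= k < s + M)%N -> ~~ E k w i j].

(** This is f_e(M) for the link e = (i, j). Taking the supremum over starting times makes the bounds
    uniform in time without stationarity. *)
Definition quiet_sup d (T : measurableType d) (R : realType)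
    (P : probability T R) (V : finType) (E : nat -> T -> rel V)
    (i j : V) (M : nat) : R :=
  sup (range (fun s => fine (P (quiet E i j s M)))).

Section RandomNetwork.
Context {R : realType} {d : measure_display} {T : measurableType d}.
Context (P : probability T R) {V : finType} (E : nat -> T -> rel V).
Context (hE : random_network E).
Implicit Types (i j l : V) (n k s M c : nat).

Lemma measurable_quiet i j s M : measurable (quiet E i j s M).
Proof.
rewrite (_ : quiet E i j s M =
  \bigcap_(k in [set k | (s <= k < s + M)%N]) ~` link_event E i j k); last first.
  by apply/seteqP; split=> w h k /h /negP.
by apply: bigcap_measurableType => k _; apply: measurableC.
Qed.

Lemma measurable_aoi_gt n i j c :
  measurable [set w | (c < aoi (fun k => E k w) n i j)%N].
Proof.
elim: n i j c => [|n IH] i j c.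
  rewrite (_ : [set w | _] = set0)//; apply/seteqP; split=> // w /=.
  by rewrite if_same ltn0.
have [->|ij] := eqVneq i j.
  rewrite (_ : [set w | _] = set0)//; apply/seteqP; split=> // w.
  by rewrite /mkset aoi_diag ltn0.
case: c => [|c].
  rewrite (_ : [set w | _] = setT)//; apply/seteqP; split=> // w _.
  by apply/ltn_aoiSP => //; left.
rewrite (_ : [set w | _] = [set w | (c < aoi (fun k => E k w) n i j)%N] `&`
  \bigcap_(l in [set: V]) (~` link_event E l j n.+1 `|`
     [set w | (c < aoi (fun k => E k w) n i l)%N])); last first.
  apply/seteqP; split=> w.
    move=> /(ltn_aoiSP _ _ _ ij)[//|[h1 h2]]; split=> // l _.
    by have [/h2|h] := boolP (E n.+1 w l j); [right | left; apply/negP].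
  case=> h1 h2; apply/ltn_aoiSP => //; right; split=> // l elj.
  by case: (h2 l I) => // /(_ elj).
apply: measurableI => //; apply: fin_bigcap_measurable => // l _.
by apply: measurableU => //; apply: measurableC.
Qed.

(** Induction on the last link (l, j) of the path: the age at [j] exceeds its bound at time [t] only
    if the age at [l] did so at [t - M] or the link was quiet during the [M] slots in between. A
    union bound adds one [h] per link. *)
Lemma aoi_path_tail (G : rel V) i q M (h : R) :
  (forall l j s, G l j -> (P (quiet E l j s M) <= h%:E)%E) -> path G i q ->
  forall t, (P [set w | (size q * M < aoi (fun k => E k w) t i (last i q))%N] <=
             ((size q)%:R * h)%:E)%E.
Proof.
move=> hh; elim/last_ind: q => [_ t|q j IH].
  rewrite mul0n mul0r (_ : [set w | _] = set0) ?measure0//.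
  by apply/seteqP; split=> // w; rewrite /mkset aoi_diag.
rewrite rcons_path size_rcons last_rcons => /andP[hq hlj] t.
set l := last i q in hlj *.
have h0 : 0 <= h.
  by rewrite -lee_fin (le_trans _ (hh _ _ 0%N hlj)).
(* For [t < M] there is no earlier time [t - M], but an age never exceeds the elapsed time, so the
   event is empty. *)
have [Mt|tM] := leqP M t; last first.
  rewrite (_ : [set w | _] = set0) ?measure0 ?lee_fin ?mulr_ge0//.
  apply/seteqP; split=> // w /=; have := aoi_le_time (fun k => E k w) t i j.
  rewrite mulSn; lia.
rewrite -(subnK Mt); set t' := (t - M)%N.
have sub : [set w | ((size q).+1 * M < aoi (fun k => E k w) (t' + M) i j)%N] `<=`
    [set w | (size q * M < aoi (fun k => E k w) t' i l)%N] `|`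
    quiet E l j t'.+1 M.
  move=> w /= hw.
    have [|ge_l] := ltnP (size q * M) (aoi (fun k => E k w) t' i l).
      by left.
  right=> k hk; apply/negP => Ek.
  have hk' : (t' < k <= t' + M)%N by lia.
  have := @aoiD_link _ (fun k => E k w) t' M k i j l hk' Ek.
  by rewrite mulSn in hw; lia.
apply: le_trans (le_measure _ _ _ sub) _.
- by rewrite inE; apply: measurable_aoi_gt.
- rewrite inE; apply: measurableU; first exact: measurable_aoi_gt.
  exact: measurable_quiet.
apply: le_trans (measureU2 _ (measurable_aoi_gt _ _ _ _) _) _.
  exact: measurable_quiet.
by rewrite -natr1 mulrDl mul1r EFinD leeD ?IH ?hh.
Qed.

Lemma aoi_tail (G : rel V) i j M (h : R) : 0 <= h ->
  (forall l j s, G l j -> (P (quiet E l j s M) <= h%:E)%E) -> connect G i j ->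
  forall t, (P [set w | (#|V| * M < aoi (fun k => E k w) t i j)%N] <=
             (#|V|%:R * h)%:E)%E.
Proof.
move=> h0 hh /connectP[q0 hq0 ->] t.
case/shortenP: hq0 => q hq uq _.
(* A path without repeated nodes has fewer than [#|V|] links, which gives one bound for all pairs of
   nodes. *)
have lt_q : (size q <= #|V|)%N
  by have := max_card (mem (i :: q)); rewrite (card_uniqP uq) => /ltnW.
apply: le_trans (_ : (P [set w |
    (size q * M < aoi (fun k => E k w) t i (last i q))%N] <= _)%E).
  apply: le_measure; rewrite ?inE; try exact: measurable_aoi_gt.
  by move=> w /=; apply: leq_ltn_trans; rewrite leq_mul2r lt_q orbT.
apply: le_trans (aoi_path_tail hh hq t) _.
by rewrite lee_fin ler_wpM2r// ler_nat.
Qed.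

Lemma quiet_fin i j s M : P (quiet E i j s M) \is a fin_num.
Proof. apply/fin_num_measure/measurable_quiet. Qed.

Lemma has_ubound_quiet i j M :
  has_ubound (range (fun s => fine (P (quiet E i j s M)))).
Proof.
exists 1 => _ [s _ <-].
rewrite -lee_fin fineK ?quiet_fin// probability_le1//.
exact: measurable_quiet.
Qed.

Lemma quiet_le_sup i j s M :
  (P (quiet E i j s M) <= (quiet_sup P E i j M)%:E)%E.
Proof.
rewrite -[leLHS]fineK ?quiet_fin// lee_fin.
by apply: (ub_le_sup (has_ubound_quiet i j M)); exists s.
Qed.

Lemma quiet_sup_le i j M (x : R) :
  (forall s, (P (quiet E i j s M) <= x%:E)%E) -> quiet_sup P E i j M <= x.
Proof.
move=> hx; apply: ge_sup; first by exists (fine (P (quiet E i j 0 M))); exists 0%N.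
by move=> _ [s _ <-]; rewrite -lee_fin fineK ?quiet_fin.
Qed.

Lemma quiet_sup_ge0 i j M : 0 <= quiet_sup P E i j M.
Proof. by rewrite -lee_fin (le_trans _ (quiet_le_sup i j 0 M)). Qed.

Lemma quiet_sup_dec i j m n :
  (m <= n)%N -> quiet_sup P E i j n <= quiet_sup P E i j m.
Proof.
move=> mn; apply: quiet_sup_le => s; apply: le_trans (quiet_le_sup i j s m).
apply: le_measure; rewrite ?inE; try exact: measurable_quiet.
by move=> w h k /andP[sk ks]; apply: h; lia.
Qed.

Lemma quiet_sup_window i j kappa (eps : R) :
  (forall n, (eps%:E <= P (window_event E i j kappa n))%E) ->
  quiet_sup P E i j kappa.+1 <= 1 - eps.
Proof.
move=> hw; apply: quiet_sup_le => s.
have mW : measurable (window_event E i j kappa s).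
  by apply: bigcup_measurable => k _; apply: hE.
(* [quiet] counts slots in a half-open interval, whereas [window_event] with parameter [kappa]
   covers [kappa + 1] slots. *)
rewrite (_ : quiet E i j s kappa.+1 = ~` window_event E i j kappa s).
  by rewrite probability_setC// EFinB leeB.
apply/seteqP; split=> w.
  by move=> h [k /= hk]; apply/negP/h; rewrite addnS ltnS.
move=> h k; rewrite addnS ltnS => hk; apply/negP => Ek.
by apply: h; exists k.
Qed.

(** The process reveals only whether whole windows of [eta + 1] slots contain an active link. An
    interval of more than [eta] slots is the union of the windows inside it, so it is quiet exactly
    when all their indicators vanish. *)
Lemma process_quiet i j eta s M (I : set nat) : (eta < M)%N ->
  (forall k, (s <= k < s + M - eta)%N -> I k) ->
  process_sigma_algebra
    (fun n w => \1_(window_event E i j eta n) w : R) I (quiet E i j s M).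
Proof.
move=> etaM hI.
rewrite (_ : quiet E i j s M = \bigcap_(k in [set k | (s <= k < s + M - eta)%N])
   ((fun w => \1_(window_event E i j eta k) w : R) @^-1` [set 0])); last first.
  have pre k w : ((fun w => \1_(window_event E i j eta k) w : R) @^-1` [set 0]) w
      <-> ~ window_event E i j eta k w.
    rewrite /= indicE; split.
      by move=> /eqP; rewrite pnatr_eq0 eqb0 => /negP h Ww; apply/h/mem_set.
    by move=> nW; rewrite memNset.
  apply/seteqP; split=> w.
    move=> h k /= hk; apply/pre => -[m /= hm]; apply/negP/h; lia.
  move=> h m hm; apply/negP => Em.
  (* The last window inside the interval starts at [s + M - eta - 1]; a later slot [m] is covered by
     that window, any other by the window starting at [m]. *)
  have /h /pre[] : [set k | (s <= k < s + M - eta)%N] (minn m (s + M - eta).-1).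
    by rewrite /=; lia.
  by exists m => //=; lia.
rewrite /process_sigma_algebra; set S := \bigcup_(n in I) _.
apply: (@bigcap_measurableType _ (g_sigma_algebraType S)) => k /hI Ik.
apply: sub_sigma_algebra; exists k => //.
by exists [set 0]; rewrite ?setTI.
Qed.

End RandomNetwork.

(** * Mixing coefficients *)

Section Mixing.
Context {d d' : measure_display} {T : measurableType d} {T' : measurableType d'}.
Context {R : realType} (P : probability T R) (X : nat -> T -> T').
Implicit Types (I J : set nat) (A B : set T).

Lemma process_sigma_algebraS I J : I `<=` J ->
  process_sigma_algebra X I `<=` process_sigma_algebra X J.
Proof.
move=> IJ; apply: sub_smallest2r; first exact: smallest_sigma_algebra.
exact: bigcup_subset.
Qed.

Lemma process_sigma_algebra0 I : process_sigma_algebra X I set0.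
Proof.
by have [] := @smallest_sigma_algebra _ setT
  (\bigcup_(n in I) preimage_set_system setT (X n) measurable).
Qed.

Lemma alpha_dep_ge (SA SB : set (set T)) A B : SA A -> SB B ->
  (`|P (A `&` B) - P A * P B| <= alpha_dep P SA SB)%E.
Proof. by move=> hA hB; apply: ereal_sup_ubound; exists (A, B). Qed.

Lemma alpha_dep_le_coef l n :
  (alpha_dep P (process_sigma_algebra X [set k | (k <= l)%N])
               (process_sigma_algebra X [set k | (l + n <= k)%N])
   <= alpha_coef P X n)%E.
Proof. by apply: ereal_sup_ubound; exists l. Qed.

Lemma alpha_coef_ge0 n : (0 <= alpha_coef P X n)%E.
Proof.
apply: le_trans (alpha_dep_le_coef 0 n).
have := alpha_dep_ge (@process_sigma_algebra0 [set k | (k <= 0)%N])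
  (@process_sigma_algebra0 [set k | (0 + n <= k)%N]).
by apply: le_trans; exact: abse_ge0.
Qed.

Lemma alpha_coef_dec m n : (m <= n)%N -> (alpha_coef P X n <= alpha_coef P X m)%E.
Proof.
move=> mn; apply: ge_ereal_sup => _ [l _ <-].
apply: le_trans (alpha_dep_le_coef l m).
apply: ereal_sup_le => _ [[A B] [/= hA hB] <-]; exists (A, B) => //; split=> //=.
by apply: process_sigma_algebraS hB => k /=; apply: leq_trans; rewrite leq_add2l.
Qed.

(** For [n > 0] the weight n^(p-1) is positive, so an infinite coefficient would make the series
    diverge. *)
Lemma strongly_mixing_fin (p : R) n :
  strongly_mixing P p X -> (0 < n)%N -> alpha_coef P X n \is a fin_num.
Proof.
move=> [_ hsum] n0; rewrite ge0_fin_numE ?alpha_coef_ge0//.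
have pos k : (0 <= (k%:R `^ (p - 1))%:E * alpha_coef P X k)%E.
  by rewrite mule_ge0 ?alpha_coef_ge0// lee_fin powR_ge0.
have := le_lt_trans (nneseries_lim_ge n.+1 (fun k _ _ => pos k)) hsum.
rewrite big_mkcond/= big_nat_recr//= n0 orbT => /(le_lt_trans (leeDr _ _)) h.
have {h} : ((n%:R `^ (p - 1))%:E * alpha_coef P X n < +oo)%E.
  by apply: h; apply: sume_ge0 => k _; case: ifP.
case: (alpha_coef P X n) => [r _| |]//; first by rewrite ltry.
by rewrite gt0_muley ?ltxx// lte_fin powR_gt0// ltr0n.
Qed.

Lemma strongly_mixing_sum (p : R) : strongly_mixing P p X ->
  exists S, forall N,
    \sum_(1 <= n < N) n%:R `^ (p - 1) * fine (alpha_coef P X n) <= S.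
Proof.
move=> hm; have hsum := hm.2.
have pos k : (0 <= (k%:R `^ (p - 1))%:E * alpha_coef P X k)%E.
  by rewrite mule_ge0 ?alpha_coef_ge0// lee_fin powR_ge0.
set total := (X in (X < +oo)%E) in hsum.
have total0 : (0 <= total)%E by apply: nneseries_ge0.
exists (fine total) => N; rewrite -lee_fin fineK ?ge0_fin_numE//.
apply: le_trans (nneseries_lim_ge N (fun k _ _ => pos k)).
case: N => [|N]; first by rewrite !big_geq.
(* Whether the series contains index 0 depends on [p]; in either case that term is nonnegative and
   is dropped. *)
rewrite [leRHS]big_mkcond/= [leRHS]big_ltn//= -sumEFin.
apply: le_trans (leeDr _ _); last by case: ifP.
rewrite le_eqVlt; apply/orP; left; apply/eqP/eq_big_nat => n /andP[n0 _].
by rewrite n0 orbT EFinM fineK// (strongly_mixing_fin hm).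
Qed.

End Mixing.

(** * Decay of the inactivity probabilities *)

Lemma quiet_sup_mul (R : realType) d (T : measurableType d) (P : probability T R)
    (V : finType) (E : nat -> T -> rel V) (hE : random_network E) (i j : V)
    (eta a g b : nat) :
  let alpha := alpha_coef P
    (fun n w => \1_(window_event E i j eta n) w : R) g in
  alpha \is a fin_num -> (eta < a)%N -> (eta < b)%N ->
  quiet_sup P E i j (a + g + b)
    <= quiet_sup P E i j a * quiet_sup P E i j b + fine alpha.
Proof.
move=> alpha alpha_fin etaa etab; apply: quiet_sup_le => // s.
(* The long quiet event lies in the intersection of [A] and [B]. The windows inside the first
   interval start before [s + a], those inside the second at [s + a + g] or later, so mixing at
   distance [g] decouples the two events. *)
set A := quiet E i j s a; set B := quiet E i j (s + a + g) b.
have mA : measurable A by exact: measurable_quiet.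
have mB : measurable B by exact: measurable_quiet.
have AB : (`|P (A `&` B) - P A * P B| <= alpha)%E.
  apply: le_trans (alpha_dep_le_coef _ _ (s + a) g); apply: alpha_dep_ge.
    by apply: process_quiet => // k /=; lia.
  by apply: process_quiet => // k /=; lia.
suff main : (P (A `&` B) <=
    (quiet_sup P E i j a * quiet_sup P E i j b + fine alpha)%:E)%E.
  apply: le_trans main; apply: le_measure; rewrite ?inE.
  - exact: measurable_quiet.
  - exact: measurableI.
  - by move=> w h; split=> k hk; apply: h; lia.
have := quiet_le_sup P hE i j s a; have := quiet_le_sup P hE i j (s + a + g) b.
rewrite -/A -/B; move: AB; have : (0 <= P A)%E by []; have : (0 <= P B)%E by [].
have : P B \is a fin_num by exact: fin_num_measure.
have : P A \is a fin_num by exact: fin_num_measure.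
have : P (A `&` B) \is a fin_num by apply: fin_num_measure; exact: measurableI.
case: (P (A `&` B)) => // r _; case: (P A) => // x _; case: (P B) => // y _.
rewrite -[alpha]fineK// -EFinM -EFinB /= !lee_fin => y0 x0 /ler_normlP[_ h] hy hx.
have : x * y <= quiet_sup P E i j a * quiet_sup P E i j b by exact: ler_pM.
lra.
Qed.

Lemma bounded_sums_quiet_sup (R : realType) d (T : measurableType d)
    (P : probability T R) (V : finType) (E : nat -> T -> rel V)
    (hE : random_network E) (i j : V) (p eps : R) (kappa eta : nat) :
  0 <= p -> 0 < eps ->
  (forall n, (eps%:E <= P (window_event E i j kappa n))%E) ->
  strongly_mixing P p (fun n w => \1_(window_event E i j eta n) w : R) ->
  bounded_sums (fun k => (3 `^ p) ^+ k * quiet_sup P E i j (3 ^ k)).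
Proof.
move=> p0 eps0 hw hm.
(* The length [(maxn kappa eta).+1] is at least [kappa + 1], where the bound [1 - eps] holds, and
   exceeds [eta], as the splitting demands. *)
apply: (@bounded_sums_submultiplicative _ _ (fun n => fine (alpha_coef P
   (fun n w => \1_(window_event E i j eta n) w : R) n)) eps p eta
   (maxn kappa eta).+1) => //.
- by move=> n; exact: quiet_sup_ge0.
- by move=> m n; exact: quiet_sup_dec.
- by move=> n; rewrite fine_ge0// alpha_coef_ge0.
- move=> m n /andP[m0 mn]; apply: fine_le; last exact: alpha_coef_dec.
    by apply: strongly_mixing_fin hm _; exact: leq_trans mn.
  exact: strongly_mixing_fin hm _.
- exact: strongly_mixing_sum.
- move=> a g b etaa etab g0; apply: quiet_sup_mul => //.
  exact: strongly_mixing_fin hm _.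
- by rewrite ltnS leq_maxr.
- have := quiet_sup_window hE hw; apply: le_trans.
  by apply: quiet_sup_dec => //; rewrite ltnS leq_maxl.
Qed.

(** * Operations on sequences with bounded partial sums *)

Lemma bounded_sumsZ (R : numDomainType) (a : R) (u : nat -> R) :
  0 <= a -> bounded_sums u -> bounded_sums (fun k => a * u k).
Proof. by move=> a0 [C hC]; exists (a * C) => N; rewrite -mulr_sumr ler_wpM2l. Qed.

Lemma bounded_sums_sum (R : numDomainType) (I : finType) (Q : pred I)
    (u : I -> nat -> R) :
  (forall i, Q i -> bounded_sums (u i)) ->
  bounded_sums (fun k => \sum_(i | Q i) u i k).
Proof.
move=> hu.
have /choice[C hC] i : exists C, Q i -> forall N, \sum_(0 <= k < N) u i k <= C.
  by have [/hu[C hC]|] := boolP (Q i); [exists C | exists 0].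
exists (\sum_(i | Q i) C i) => N; rewrite exchange_big/=.
by apply: ler_sum => i /hC.
Qed.

Lemma le_bounded_sums (R : numDomainType) (u v : nat -> R) :
  (forall k, u k <= v k) -> bounded_sums v -> bounded_sums u.
Proof.
by move=> uv [C hC]; exists C => N; apply: le_trans (hC N); apply: ler_sum.
Qed.

Lemma sum_nat_shift (R : nmodType) (u : nat -> R) (n N : nat) :
  \sum_(n <= k < n + N) u k = \sum_(0 <= k < N) u (n + k)%N.
Proof.
rewrite -{1}[n]add0n big_addn addKn.
by apply: eq_bigr => k _; rewrite addnC.
Qed.

Lemma bounded_sums_shift (R : numDomainType) (u : nat -> R) (n : nat) :
  (forall k, 0 <= u k) -> bounded_sums u -> bounded_sums (fun k => u (n + k)%N).
Proof.
move=> u0 [C hC]; exists C => N; apply: le_trans (hC (n + N)%N).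
rewrite [leRHS](big_cat_nat (n := n)) ?leq_addr//= (sum_nat_shift u n N).
by rewrite lerDr sumr_ge0.
Qed.

Lemma bounded_sums_cons (R : numDomainType) (u : nat -> R) :
  0 <= u 0%N -> bounded_sums (fun k => u k.+1) -> bounded_sums u.
Proof.
move=> u0 [C hC]; exists (u 0%N + C) => -[|N].
  by rewrite big_geq// addr_ge0//; have := hC 0%N; rewrite big_geq.
by rewrite big_nat_recl// lerD2l.
Qed.

Lemma nneseries_le_bound (R : realType) (u : nat -> R) (C : R) :
  (forall k, 0 <= u k) -> (forall N, \sum_(0 <= k < N) u k <= C) ->
  (\sum_(0 <= k <oo) (u k)%:E <= C%:E)%E.
Proof.
move=> u0 hC; apply: lime_le.
  by apply: is_cvg_nneseries => k _ _; rewrite lee_fin.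
by apply: nearW => N; rewrite sumEFin lee_fin.
Qed.

(** Choose [K] so that the partial sum up to [K] is within 1 of the supremum of all partial sums. *)
Lemma bounded_sums_tail (R : realType) (u : nat -> R) :
  (forall k, 0 <= u k) -> bounded_sums u ->
  exists K, forall N, \sum_(0 <= k < N) u (K + k)%N <= 1.
Proof.
move=> u0 [C hC]; set A := range (fun N => \sum_(0 <= k < N) u k).
have supA : has_sup A.
  by split; [exists (\sum_(0 <= k < 0) u k); exists 0%N | exists C => _ [N _ <-]].
have [_ [K _ <-] hK] := sup_adherent (ltr01 : 0 < 1 :> R) supA.
exists K => N; have : \sum_(0 <= k < K + N) u k <= sup A.
  by apply: sup_upper_bound => //; exists (K + N)%N.
rewrite (big_cat_nat (n := K)) ?leq_addr//= (sum_nat_shift u K N); lra.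
Qed.

Lemma nat_bracket (a : nat -> nat) (m : nat) :
  (a 0%N <= m)%N -> (exists k, (m < a k)%N) ->
  exists k, (a k <= m < a k.+1)%N.
Proof.
move=> a0 /ex_minnP[[|k] hk min_k]; first by rewrite ltnNge a0 in hk.
by exists k; rewrite hk andbT leqNgt; apply/negP => /min_k; rewrite ltnn.
Qed.

(** * Discrete measures and the dominating variable *)

Section DiracSeries.
Context {R : realType} (w : nat -> R) (v : nat -> nat).
Context (w0 : forall k, 0 <= w k).

Definition dirac_series : {measure set nat -> \bar R} :=
  mseries (fun k => mscale (NngNum (w0 k)) (dirac (v k))) 0.

Lemma dirac_seriesE (A : set nat) :
  dirac_series A = (\sum_(0 <= k <oo) (w k * (v k \in A)%:R)%:E)%E.
Proof. by apply: eq_eseriesr => k _; rewrite /= /mscale/= /dirac indicE. Qed.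

Lemma integral_dirac_series (f : nat -> \bar R) : (forall m, 0 <= f m)%E ->
  (\int[dirac_series]_m f m = \sum_(0 <= k <oo) (w k)%:E * f (v k))%E.
Proof.
move=> f0.
rewrite ge0_integral_measure_series//; apply: eq_eseriesr => k _.
by rewrite ge0_integral_mscale//= integral_dirac// diracT mul1e.
Qed.

End DiracSeries.

(* The variable takes the value (N + 1) 3^(K + k + 1) with probability
   H (K + k), where K is so large that these masses sum to at most 1, and the
   value (N + 1) 3^K with the remaining probability. *)
Lemma dominating_variable (R : realType) (p : R) (H : nat -> R) (N : nat) :
  0 <= p -> (forall k, 0 <= H k) ->
  bounded_sums (fun k => (3 `^ p) ^+ k * H k) ->
  exists (d : measure_display) (T : measurableType d) (P : probability T R)
    (X : {RV P >-> nat}),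
    ('E_P[fun w : T => ((X w)%:R `^ p)%R] < +oo)%E /\
    forall (m : nat) (x : \bar R), (x <= 1)%E ->
      (forall k, (N * 3 ^ k <= m)%N -> (x <= (H k)%:E)%E) ->
      (x <= P [set w | (m < X w)%N])%E.
Proof.
move=> p0 H0 hH.
have c1 : 1 <= (3 : R) `^ p by rewrite powR_ge1// ler1n.
set c : R := 3 `^ p in hH c1.
have c0 : 0 <= c by rewrite (le_trans _ c1).
have [K hK] : exists K, forall N, \sum_(0 <= k < N) H (K + k)%N <= 1.
  apply: bounded_sums_tail => //; apply: le_bounded_sums hH => k.
  by rewrite ler_peMl// exprn_ege1.
pose rest := fine (\sum_(0 <= k <oo) (H (K + k)%N)%:E)%E.
have series_ge0 : (0 <= \sum_(0 <= k <oo) (H (K + k)%N)%:E)%E.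
  by apply: nneseries_ge0 => k _ _; rewrite lee_fin.
have series_le1 : (\sum_(0 <= k <oo) (H (K + k)%N)%:E <= 1)%E.
  exact: nneseries_le_bound.
have restE : (\sum_(0 <= k <oo) (H (K + k)%N)%:E = rest%:E)%E.
  by rewrite fineK// ge0_fin_numE// (le_lt_trans series_le1)// ltry.
have rest1 : rest <= 1 by rewrite -lee_fin -restE.
pose w k := if k is k'.+1 then H (K + k')%N else 1 - rest.
have w0 k : 0 <= w k by case: k => //=; rewrite subr_ge0.
(* The factor [N.+1] instead of [N] keeps the values unbounded also for [N = 0]. *)
pose v k := (N.+1 * 3 ^ (K + k))%N.
have w1 : (\sum_(0 <= k <oo) (w k)%:E = 1)%E.
  rewrite nneseries_recl; [|by move=> k _; rewrite lee_fin|by []].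
  rewrite -(@nneseries_addn _ (fun k => (w k)%:E) 1%N); last first.
    by move=> k; rewrite lee_fin.
  under eq_eseriesr do rewrite addn1 /=.
  by rewrite restE /= -EFinD subrK.
pose mu := dirac_series v w0.
have mu1 : mu setT = 1%E.
  rewrite dirac_seriesE -[RHS]w1; apply: eq_eseriesr => k _.
  by rewrite in_setT mulr1.
pose P : probability nat R := HB.pack (Measure.sort mu)
  (Measure.class mu) (Measure_isProbability.Build _ _ _ mu mu1).
have mid : measurable_fun setT (@idfun nat) by exact: measurable_id.
pose X : {RV P >-> nat} :=
  HB.pack (@idfun nat) (isMeasurableFun.Build _ _ _ _ _ mid).
exists _, nat, P, X; split.
  rewrite unlock.
  rewrite (_ : (\int[P]_m _)%E = (\int[mu]_m (m%:R `^ p)%:E)%E)//.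
  rewrite integral_dirac_series => [|m]; last by rewrite lee_fin powR_ge0.
  have [C hC] : bounded_sums (fun k => w k * (v k)%:R `^ p).
    apply: bounded_sums_cons; first by rewrite mulr_ge0// powR_ge0.
    (* For index k + 1 the moment term is (N + 1)^p c^(K+k+1) H(K + k), a constant multiple of the
       shifted series in the hypothesis. *)
    have := bounded_sums_shift K (fun k => mulr_ge0 (exprn_ge0 k c0) (H0 k)) hH.
    move=> /(bounded_sumsZ (mulr_ge0 (powR_ge0 N.+1%:R p) c0)).
    apply: le_bounded_sums => k; rewrite /v /= natrM powRM// powR_nat_exp.
    rewrite addnS exprS -/c le_eqVlt; apply/orP; left; apply/eqP; ring.
  apply: le_lt_trans (ltry C); apply: le_trans (nneseries_le_bound _ hC) => //.
  by move=> k; rewrite mulr_ge0// powR_ge0.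
move=> m x x1 hx.
rewrite (_ : P _ = mu [set n | (m < n)%N])// dirac_seriesE.
have pos k : (0 <= (w k * (v k \in [set n | (m < n)%N])%:R)%:E)%E.
  by rewrite lee_fin mulr_ge0.
(* Below the least value [v 0] the tail probability is 1. Otherwise [v k <= m < v k.+1] for some
   [k], and the single atom at [v k.+1] has mass [H (K + k)], enough because
   [N * 3 ^ (K + k) <= v k <= m]. *)
have [mv0|v0m] := ltnP m (v 0%N).
  apply: (le_trans x1); rewrite -w1; apply: lee_nneseries => [k _ _|k _].
    by rewrite lee_fin.
  rewrite lee_fin mem_set ?mulr1//=; apply: leq_trans mv0 _.
  by rewrite /v leq_mul2l leq_exp2l// leq_add2l orbT.
have [|k /andP[vm mv]] := @nat_bracket v m v0m.
  exists m; rewrite /v; apply: leq_trans (ltn_expl m (isT : 1 < 3)%N) _.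
  rewrite (leq_trans (leq_pmull _ (isT : 0 < N.+1)%N))//.
  by rewrite leq_mul2l leq_exp2l// leq_addl orbT.
apply: le_trans (nneseries_lim_ge k.+2 (fun k _ _ => pos k)).
rewrite big_nat_recr//= mem_set// mulr1; apply: le_trans (leeDr _ _); last first.
  by apply: sume_ge0.
by apply: hx; apply: leq_trans vm; rewrite /v leq_mul2r leqnSn orbT.
Qed.

(** * Domination of all ages by one variable *)

Theorem theorem2 (R : realType) (d : measure_display) (T : measurableType d)
    (P : probability T R) (D : nat) (E : nat -> T -> rel 'I_D)
    (hE : random_network E)
    (p : R) (hp : 0 <= p)
    (eps : R) (heps : 0 < eps < 1) (kappa : nat) (G : rel 'I_D)
    (hssc : stoch_strongly_connected P E eps kappa G)
    (hmix : forall i j : 'I_D, G i j -> exists eta : nat,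
      strongly_mixing P p
        (fun (n : nat) (w : T) => \1_(window_event E i j eta n) w : R)) :
  exists (d' : measure_display) (T' : measurableType d')
    (P' : probability T' R) (taubar : {RV P' >-> nat}),
    ('E_P'[fun w : T' => ((taubar w)%:R `^ p)%R] < +oo)%E /\
    forall (m n : nat) (i j : 'I_D),
      (P [set w | (m < aoi (fun k => E k w) n i j)%N] <=
       P' [set w | (m < taubar w)%N])%E.
Proof.
have [eps0 _] := andP heps; have [connG hw] := hssc.
(* Summing over the finitely many links of [G] bounds every link at once, although [eta] and the
   mixing rate vary from link to link. *)
pose S k := \sum_(e : 'I_D * 'I_D | G e.1 e.2) quiet_sup P E e.1 e.2 (3 ^ k).
have S0 k : 0 <= S k by apply: sumr_ge0 => e _; exact: quiet_sup_ge0.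
have hS : bounded_sums (fun k => (3 `^ p) ^+ k * (D%:R * S k)).
  apply: (@le_bounded_sums _ _ (fun k => D%:R * \sum_(e : 'I_D * 'I_D | G e.1 e.2)
      ((3 `^ p) ^+ k * quiet_sup P E e.1 e.2 (3 ^ k)))) => [k|].
    by rewrite mulrCA ler_wpM2l// mulr_sumr.
  apply: bounded_sumsZ => //.
  apply: (@bounded_sums_sum _ _ (fun e : 'I_D * 'I_D => G e.1 e.2)
    (fun e k => (3 `^ p) ^+ k * quiet_sup P E e.1 e.2 (3 ^ k))) => e Ge.
  have [eta hm] := hmix _ _ Ge.
  by apply: (bounded_sums_quiet_sup hE hp eps0 _ hm) => n; exact: hw.
have H0 k : 0 <= D%:R * S k by rewrite mulr_ge0.
have [d' [T' [P' [X [EX hX]]]]] := dominating_variable D hp H0 hS.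
exists d', T', P', X; split=> // m n i j.
(* If [D * 3 ^ k <= m], the tail at [m] is at most the tail at [D * 3 ^ k], which the path bound
   with [M = 3 ^ k] estimates by [D * S k]. *)
apply: hX => [|k hk]; first by apply: probability_le1; exact: measurable_aoi_gt.
have hq (l j' : 'I_D) s : G l j' -> (P (quiet E l j' s (3 ^ k)) <= (S k)%:E)%E.
  move=> Glj; apply: le_trans (quiet_le_sup P hE l j' s _) _; rewrite lee_fin.
  rewrite /S (bigD1 (l, j'))//= lerDl sumr_ge0// => e _.
  exact: quiet_sup_ge0.
have := aoi_tail hE (S0 k) hq (connG i j) n; rewrite card_ord; apply: le_trans.
apply: le_measure; rewrite ?inE; try exact: measurable_aoi_gt.
by move=> w /=; apply: leq_ltn_trans.
Qed.
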